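(* Let $\eta_0>0$, $\xi>0$, $0<k_c<\infty$, $\eta_1>-2$. The variance $\sigma^2=G(0)$ of the one-dimensional FGC-SSRF with parameters $(\eta_0,\eta_1,\xi,k_c)$ is linearly proportional to $\eta_0$: $$\sigma^2=\frac{\eta_0}{2\pi}\,V_1(\eta_1,k_c\xi),$$ where $$V_1(\eta_1,x)=\begin{cases}\dfrac{1}{4\beta_1}\ln\!\left(\dfrac{x^2+2\beta_1x+1}{x^2-2\beta_1x+1}\right)+\dfrac{1}{2\beta_2}\displaystyle\sum_{l=\pm1}\tan^{-1}\!\left(\dfrac{x+l\beta_1}{\beta_2}\right), & |\eta_1|<2,\\[3mm] \tan^{-1}(x)+\dfrac{x}{1+x^2}, & \eta_1=2,\\[3mm] \dfrac{2}{\Delta}\displaystyle\sum_{l=1,2}\dfrac{(-1)^{l+1}}{\omega_l}\tan^{-1}\!\left(\dfrac{x}{\omega_l}\right), & \eta_1>2.\end{cases}$$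
   Context: The one-dimensional FGC-SSRF with parameters $(\eta_0,\eta_1,\xi,k_c)$ is the stationary, zero-mean Gaussian random field on $\mathbb{R}$ with covariance function $$G(r)=\frac{1}{2\pi}\int_{-k_c}^{k_c}e^{ikr}\,\frac{\eta_0\,\xi}{1+\eta_1(k\xi)^2+(k\xi)^4}\,dk=\frac{\eta_0}{\pi}\int_0^{k_c\xi}\frac{\cos(x r/\xi)}{1+\eta_1x^2+x^4}\,dx.$$ Notation: $\Delta=|\eta_1^2-4|^{1/2}$; $\beta_1=\frac{|2-\eta_1|^{1/2}}{2}$, $\beta_2=\frac{|2+\eta_1|^{1/2}}{2}$; $\omega_1=\left(\frac{|\eta_1-\Delta|}{2}\right)^{1/2}$, $\omega_2=\left(\frac{|\eta_1+\Delta|}{2}\right)^{1/2}$. *)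

(* Defs.v *)
From HB Require Import structures.
From mathcomp Require Import all_boot all_order all_algebra.
From mathcomp Require Import all_classical all_reals all_analysis.
From mathcomp Require Import complex.
Set Implicit Arguments.
Unset Strict Implicit.
Unset Printing Implicit Defensive.
Import Order.TTheory GRing.Theory Num.Theory.
Import numFieldNormedType.Exports.
Local Open Scope classical_set_scope.
Local Open Scope ring_scope.
Local Open Scope complex_scope.

(* e^(i t) for real t *)
Definition expi (R : realType) (t : R) : R[i] := cos t +i* sin t.

(* Lebesgue integral of a complex-valued function, taken componentwise. *)
Definition Cintegral (R : realType) (D : set R) (f : R -> R[i]) : R[i] :=
  Rintegral lebesgue_measure D (fun k => complex.Re (f k))
  +i* Rintegral lebesgue_measure D (fun k => complex.Im (f k)).

Section FGC_SSRF.
Context {R : realType}.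

Definition spectral_density (eta0 eta1 xi k : R) : R :=
  eta0 * xi / (1 + eta1 * (k * xi) ^+ 2 + (k * xi) ^+ 4).

Definition FGC_SSRF_covariance (eta0 eta1 xi kc r : R) : R[i] :=
  ((2 * pi)^-1)%:C *
  Cintegral `[- kc, kc]
    (fun k => expi (k * r) * (spectral_density eta0 eta1 xi k)%:C).

Section field.
Context {d : measure_display} {T : measurableType d} (P : probability T R).

(* Gaussian law of mean m and standard deviation |s|. The case s = 0 is the
   Dirac mass at m; it is separated because normal_prob m 0 is by convention
   the uniform law on [0, 1]. *)
Definition has_gaussian_law (Y : T -> R) :=
  exists m s : R, forall A : set R, measurable A ->
    P (Y @^-1` A) = if s == 0 then \d_m A else normal_prob m s A.

Definition gaussian_field (X : R -> {RV P >-> R}) :=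
  forall (n : nat) (t a : 'I_n -> R),
    has_gaussian_law (fun w => \sum_(i < n) a i * X (t i) w).

Definition zero_mean_field (X : R -> {RV P >-> R}) :=
  forall s : R, ('E_P[X s] = 0)%E.

(* Cov(X(s), X(s + r)) = C(r) for every location s and lag r. Together with a
   constant mean this is stationarity in the wide sense, which for a Gaussian
   field is equivalent to shift invariance of its finite-dimensional laws.
   C is complex-valued, so its being real is part of the condition. *)
Definition has_stationary_covariance (X : R -> {RV P >-> R}) (C : R -> R[i]) :=
  forall s r : R,
    exists2 c : R, covariance P (X s) (X (s + r)) = c%:E & C r = c%:C.

Record is_FGC_SSRF (eta0 eta1 xi kc : R) (X : R -> {RV P >-> R}) : Prop := {
  FGC_SSRF_gaussian : gaussian_field X;
  FGC_SSRF_zero_mean : zero_mean_field X;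
  FGC_SSRF_stationary :
    has_stationary_covariance X (FGC_SSRF_covariance eta0 eta1 xi kc) }.

End field.

Definition Delta (eta1 : R) : R := Num.sqrt `|eta1 ^+ 2 - 4|.
Definition beta1 (eta1 : R) : R := Num.sqrt `|2 - eta1| / 2.
Definition beta2 (eta1 : R) : R := Num.sqrt `|2 + eta1| / 2.
Definition omega1 (eta1 : R) : R := Num.sqrt (`|eta1 - Delta eta1| / 2).
Definition omega2 (eta1 : R) : R := Num.sqrt (`|eta1 + Delta eta1| / 2).
Definition omega (eta1 : R) (l : nat) : R :=
  if l == 1%N then omega1 eta1 else omega2 eta1.

(* Meant for eta1 > -2; the last case is then eta1 > 2. *)
Definition V1 (eta1 x : R) : R :=
  let b1 := beta1 eta1 in
  let b2 := beta2 eta1 in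
  if `|eta1| < 2 then
    1 / (4 * b1)
      * ln ((x ^+ 2 + 2 * b1 * x + 1) / (x ^+ 2 - 2 * b1 * x + 1))
    + 1 / (2 * b2) * \sum_(l <- [:: 1; -1]) atan ((x + l * b1) / b2)
  else if eta1 == 2 then
    atan x + x / (1 + x ^+ 2)
  else
    2 / Delta eta1
      * \sum_(1 <= l < 3) (-1) ^+ l.+1 / omega eta1 l * atan (x / omega eta1 l).

End FGC_SSRF.

(* Main.v *)
(* V1 eta1 is an odd primitive of 2 / (1 + eta1 x^2 + x^4), so the integral of the
   spectral density over the symmetric band follows from the fundamental theorem
   of calculus. Each case of V1 comes from partial fractions along a factorization
   of the quartic:
   - |eta1| < 2: (x^2 + 2 b x + 1) (x^2 - 2 b x + 1) with b = beta1 eta1, where the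
     factors are (x + b)^2 + (beta2 eta1)^2 and (x - b)^2 + (beta2 eta1)^2;
   - eta1 = 2: (x^2 + 1)^2;
   - eta1 > 2: (x^2 + w1^2) (x^2 + w2^2) with wl = omega eta1 l and w1 w2 = 1. *)
Require Import Defs.
From mathcomp Require Import all_boot all_order all_algebra.
From mathcomp Require Import all_classical all_reals all_analysis.
From mathcomp Require Import complex.
From mathcomp Require Import ring lra.
Import Order.TTheory GRing.Theory Num.Theory.
Import numFieldNormedType.Exports.
Local Open Scope classical_set_scope.
Local Open Scope ring_scope.
Local Open Scope complex_scope.

Lemma is_derive_atan_affine {R : realType} (a x : R) {c : R} : 0 < c ->
  is_derive x 1 (fun y => atan ((y + a) / c)) (c / (c ^+ 2 + (x + a) ^+ 2)).
Proof.
move=> c0.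
have dg : is_derive x 1 (fun y : R => (y + a) / c) (c^-1).
  have -> : (fun y : R => (y + a) / c) = c^-1 \*: (id + cst a).
    by apply/funext => y /=; rewrite mulrC.
  by apply: is_derive_eq; rewrite addr0 /GRing.scale/= mulr1.
apply: (@is_derive_eq _ _ _ (atan \o (fun y : R => (y + a) / c))).
have p : 0 < c ^+ 2 + (x + a) ^+ 2 by rewrite ltr_pwDl ?exprn_gt0// sqr_ge0.
by field; rewrite !gt_eqF//.
Qed.

(** Completing the square leaves the constant [1 - b ^+ 2 > 0]. The sign of [b] is free, so both
    factors of the quartic are instances, at [b] and [- b]. *)
Lemma quadratic_gt0 {R : realType} {b : R} (x : R) : b ^+ 2 < 1 ->
  0 < x ^+ 2 + 2 * b * x + 1.
Proof. by move=> b1; have := sqr_ge0 (x + b); nra. Qed.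

Lemma is_derive_ln_quadratic {R : realType} {b : R} (x : R) : b ^+ 2 < 1 ->
  is_derive x 1 (fun y => ln (y ^+ 2 + 2 * b * y + 1))
    ((2 * x + 2 * b) / (x ^+ 2 + 2 * b * x + 1)).
Proof.
move=> b1.
have dg : is_derive x 1 (fun y : R => y ^+ 2 + 2 * b * y + 1) (2 * x + 2 * b).
  have -> : (fun y : R => y ^+ 2 + 2 * b * y + 1)
      = id ^+ 2 + (2 * b) \*: id + cst 1.
    by apply/funext => y /=.
  by apply: is_derive_eq; rewrite addr0 /GRing.scale/= expr1; ring.
have dl := is_derive1_ln (quadratic_gt0 x b1).
apply: (@is_derive_eq _ _ _ (@ln R \o (fun y : R => y ^+ 2 + 2 * b * y + 1))).
by rewrite mulrC.
Qed.

(** Let p and q be the two quadratics. Since b^2 + c^2 = 1, they are (x + b)^2 + c^2 and (x - b)^2 +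
    c^2. The logarithm contributes (1 - x^2) / (p q) and the arctangents (1 + x^2) / (p q). *)
Lemma is_derive_quartic_lt2 {R : realType} {b c : R} (x : R) :
  0 < b -> 0 < c -> b ^+ 2 + c ^+ 2 = 1 ->
  is_derive x 1 (fun y =>
    1 / (4 * b) * ln ((y ^+ 2 + 2 * b * y + 1) / (y ^+ 2 - 2 * b * y + 1))
    + 1 / (2 * c) * \sum_(l <- [:: 1; -1]) atan ((y + l * b) / c))
    (2 / (1 + (2 - 4 * b ^+ 2) * x ^+ 2 + x ^+ 4)).
Proof.
move=> b0 c0 bc.
have b1 : b ^+ 2 < 1 by nra.
have Nb1 : (- b) ^+ 2 < 1 by rewrite sqrrN.
(* The logarithm of the quotient splits because both quadratics are positive; the function becomes a
   linear combination to which the derivative rules apply. *)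
have -> : (fun y : R =>
    1 / (4 * b) * ln ((y ^+ 2 + 2 * b * y + 1) / (y ^+ 2 - 2 * b * y + 1))
    + 1 / (2 * c) * \sum_(l <- [:: 1; -1]) atan ((y + l * b) / c)) =
  (1 / (4 * b)) \*: ((fun y => ln (y ^+ 2 + 2 * b * y + 1))
                   - (fun y => ln (y ^+ 2 + 2 * (- b) * y + 1)))
  + (1 / (2 * c)) \*: ((fun y => atan ((y + b) / c))
                     + (fun y => atan ((y + - b) / c))).
  apply/funext => y /=.
  have -> : y ^+ 2 - 2 * b * y + 1 = y ^+ 2 + 2 * (- b) * y + 1 by ring.
  rewrite ln_div ?posrE ?quadratic_gt0//.
  by rewrite !big_cons big_nil !mul1r mulN1r addr0.
have := is_derive_ln_quadratic x b1; have := is_derive_ln_quadratic x Nb1.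
have := is_derive_atan_affine b x c0; have := is_derive_atan_affine (- b) x c0.
move=> d1 d2 d3 d4.
apply: (is_derive_eq (is_deriveD (is_deriveZ _ (is_deriveB d4 d3))
                                 (is_deriveZ _ (is_deriveD d2 d1)))).
rewrite /GRing.scale/=.
have p := quadratic_gt0 x b1; have q := quadratic_gt0 x Nb1.
have -> : c ^+ 2 + (x + b) ^+ 2 = x ^+ 2 + 2 * b * x + 1 by nra.
have -> : c ^+ 2 + (x + - b) ^+ 2 = x ^+ 2 + 2 * (- b) * x + 1 by nra.
have -> : 1 + (2 - 4 * b ^+ 2) * x ^+ 2 + x ^+ 4 =
  (x ^+ 2 + 2 * b * x + 1) * (x ^+ 2 + 2 * (- b) * x + 1) by ring.
by field; rewrite !gt_eqF.
Qed.

(** The rational term has derivative (1 - x^2) / (1 + x^2)^2, which with 1 / (1 + x^2) adds up to 2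
    / (1 + x^2)^2. *)
Lemma is_derive_quartic_eq2 {R : realType} (x : R) :
  is_derive x 1 (fun y => atan y + y / (1 + y ^+ 2))
    (2 / (1 + 2 * x ^+ 2 + x ^+ 4)).
Proof.
have x1 : 1 + x ^+ 2 != 0 by rewrite gt_eqF// ltr_pwDl// sqr_ge0.
have d1 : is_derive x 1 (fun y : R => 1 + y ^+ 2) (2 * x).
  have -> : (fun y : R => 1 + y ^+ 2) = cst 1 + id ^+ 2 by apply/funext.
  by apply: is_derive_eq; rewrite add0r /GRing.scale/= expr1 mulr1.
have d2 := @is_deriveV _ (fun y : R => 1 + y ^+ 2) _ _ _ x1 d1.
have -> : (fun y : R => atan y + y / (1 + y ^+ 2))
    = @atan R + id * (fun y : R => (1 + y ^+ 2)^-1) by apply/funext.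
apply: is_derive_eq; rewrite /GRing.scale/=.
have -> : 1 + 2 * x ^+ 2 + x ^+ 4 = (1 + x ^+ 2) ^+ 2 by ring.
by field.
Qed.

(** The difference of 1 / (w1^2 + x^2) and 1 / (w2^2 + x^2) has numerator w2^2 - w1^2 = D, which the
    factor [2 / D] cancels. *)
Lemma is_derive_quartic_gt2 {R : realType} {D w1 w2 : R} (x : R) :
  0 < D -> 0 < w1 -> 0 < w2 -> w2 ^+ 2 - w1 ^+ 2 = D -> w1 * w2 = 1 ->
  is_derive x 1 (fun y => 2 / D * (1 / w1 * atan (y / w1) - 1 / w2 * atan (y / w2)))
    (2 / (1 + (w1 ^+ 2 + w2 ^+ 2) * x ^+ 2 + x ^+ 4)).
Proof.
move=> D0 w10 w20 DE w12.
have e w : (fun y : R => atan ((y + 0) / w)) = (fun y => atan (y / w)).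
  by apply/funext => y; rewrite addr0.
have := is_derive_atan_affine 0 x w10; have := is_derive_atan_affine 0 x w20.
rewrite !e addr0 => d2 d1.
have -> : (fun y : R => 2 / D * (1 / w1 * atan (y / w1) - 1 / w2 * atan (y / w2)))
  = (2 / D) \*: ((1 / w1) \*: (fun y => atan (y / w1))
                - (1 / w2) \*: (fun y => atan (y / w2))).
  by apply/funext.
apply: is_derive_eq; rewrite /GRing.scale/=.
have p1 : 0 < w1 ^+ 2 + x ^+ 2 by rewrite ltr_pwDl ?exprn_gt0// sqr_ge0.
have p2 : 0 < w2 ^+ 2 + x ^+ 2 by rewrite ltr_pwDl ?exprn_gt0// sqr_ge0.
have -> : 1 + (w1 ^+ 2 + w2 ^+ 2) * x ^+ 2 + x ^+ 4
    = (w1 ^+ 2 + x ^+ 2) * (w2 ^+ 2 + x ^+ 2).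
  (* The constant term 1 is read as (w1 w2)^2. *)
  by rewrite -(expr1n R 2) -w12; ring.
rewrite -DE in D0 *.
by field; rewrite !gt_eqF.
Qed.

Lemma sqr_beta1 {R : realType} {eta1 : R} : eta1 < 2 ->
  beta1 eta1 ^+ 2 = (2 - eta1) / 4.
Proof.
by move=> ?; rewrite /beta1 ger0_norm ?expr_div_n ?sqr_sqrtr; [field|lra..].
Qed.

Lemma is_derive_V1 {R : realType} {eta1 : R} (x : R) : -2 < eta1 ->
  is_derive x 1 (V1 eta1) (2 / (1 + eta1 * x ^+ 2 + x ^+ 4)).
Proof.
move=> eta2; rewrite /V1.
have [lt2|ge2] := ltrP `|eta1| 2.
  move: lt2; rewrite ltr_norml => /andP[_ lt2].
  have sq1 : beta1 eta1 ^+ 2 = (2 - eta1) / 4 by exact: sqr_beta1.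
  have sq2 : beta2 eta1 ^+ 2 = (2 + eta1) / 4.
    by rewrite /beta2 ger0_norm ?expr_div_n ?sqr_sqrtr; [field|lra..].
  have b10 : 0 < beta1 eta1 by rewrite divr_gt0// sqrtr_gt0 gtr0_norm; lra.
  have b20 : 0 < beta2 eta1 by rewrite divr_gt0// sqrtr_gt0 gtr0_norm; lra.
  have b12 : beta1 eta1 ^+ 2 + beta2 eta1 ^+ 2 = 1 by rewrite sq1 sq2; field.
  have := is_derive_quartic_lt2 x b10 b20 b12.
  by rewrite (_ : 2 - 4 * beta1 eta1 ^+ 2 = eta1)// sq1; field.
have {}ge2 : 2 <= eta1.
  by move: ge2; rewrite ler_normr => /orP[//|]; lra.
have [->|ne2] := eqVneq eta1 2; first exact: is_derive_quartic_eq2.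
have gt2 : 2 < eta1 by rewrite lt_neqAle eq_sym ne2.
have D0 : 0 < Delta eta1 by rewrite sqrtr_gt0 normr_gt0 gt_eqF//; nra.
have DE : (Delta eta1) ^+ 2 = eta1 ^+ 2 - 4.
  by rewrite sqr_sqrtr// ger0_norm//; nra.
(* Delta^2 = eta1^2 - 4 < eta1^2; this removes the absolute value in [omega1]. *)
have Dlt : Delta eta1 < eta1 by nra.
have sq1 : (omega1 eta1) ^+ 2 = (eta1 - Delta eta1) / 2.
  by rewrite sqr_sqrtr ger0_norm//; lra.
have sq2 : (omega2 eta1) ^+ 2 = (eta1 + Delta eta1) / 2.
  by rewrite sqr_sqrtr ger0_norm//; lra.
have w10 : 0 < omega1 eta1 by rewrite sqrtr_gt0 ger0_norm; lra.
have w20 : 0 < omega2 eta1 by rewrite sqrtr_gt0 ger0_norm; lra.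
(* The squared product is (eta1^2 - Delta^2) / 4 = 1, and the product is nonnegative. *)
have w12 : omega1 eta1 * omega2 eta1 = 1.
  apply/eqP; rewrite -(@eqrXn2 _ 2) ?mulr_ge0// ?ltW//.
  by apply/eqP; rewrite exprMn sq1 sq2; nra.
have wD : omega2 eta1 ^+ 2 - omega1 eta1 ^+ 2 = Delta eta1 by rewrite sq1 sq2; field.
have := is_derive_quartic_gt2 x D0 w10 w20 wD w12.
have -> : omega1 eta1 ^+ 2 + omega2 eta1 ^+ 2 = eta1 by rewrite sq1 sq2; field.
congr is_derive; apply/funext => y.
rewrite big_nat_recr//= big_nat1 /omega/=.
by congr (_ * _); ring.
Qed.

(** For |eta1| < 2, negating x swaps the two quadratics, which inverts the argument of the
    logarithm, and exchanges the two arctangents up to sign. The other cases rest on the oddness of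
    [atan]. *)
Lemma V1N {R : realType} (eta1 x : R) : V1 eta1 (- x) = - V1 eta1 x.
Proof.
rewrite /V1; case: ifPn => [|_]; last case: ifPn => _.
- rewrite ltr_norml => /andP[eta2 lt2].
  have b1 : beta1 eta1 ^+ 2 < 1 by rewrite sqr_beta1//; lra.
  have Nb1 : (- beta1 eta1) ^+ 2 < 1 by rewrite sqrrN.
  have p := quadratic_gt0 x b1; have q := quadratic_gt0 x Nb1.
  have qE : x ^+ 2 - 2 * beta1 eta1 * x + 1 =
      x ^+ 2 + 2 * (- beta1 eta1) * x + 1 by ring.
  have -> : (- x) ^+ 2 + 2 * beta1 eta1 * - x + 1 =
      x ^+ 2 + 2 * (- beta1 eta1) * x + 1 by ring.
  have -> : (- x) ^+ 2 - 2 * beta1 eta1 * - x + 1 =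
      x ^+ 2 + 2 * beta1 eta1 * x + 1 by ring.
  rewrite qE !ln_div ?posrE// !big_cons !big_nil !mul1r !mulN1r !addr0.
  have -> : - x + beta1 eta1 = - (x - beta1 eta1) by ring.
  by rewrite -opprD !mulNr !atanN; ring.
- by rewrite atanN sqrrN mulNr opprD.
- by rewrite ![\sum_(1 <= _ < 3) _]big_nat_recr//= !big_nat1 !mulNr !atanN; ring.
Qed.

Lemma FGC_SSRF_covariance0 {R : realType} (eta0 : R) {eta1 xi kc : R}
    (hxi : 0 < xi) (hkc : 0 < kc) (heta1 : -2 < eta1) :
  FGC_SSRF_covariance eta0 eta1 xi kc 0
    = (eta0 / (2 * pi) * V1 eta1 (kc * xi))%:C.
Proof.
(* The quartic is (y^2 - 1)^2 + (2 + eta1) y^2, whose two terms are nonnegative and never vanish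
   together; for eta1 >= 2 its coefficients are already nonnegative. *)
have q0 (y : R) : 0 < 1 + eta1 * y ^+ 2 + y ^+ 4.
  have -> : y ^+ 4 = y ^+ 2 * y ^+ 2 by ring.
  have y0 := sqr_ge0 y; have [lt2|ge2] := ltrP eta1 2; last by nra.
  by have := sqr_ge0 (y ^+ 2 - 1); nra.
have q0' (y : R) : 1 + eta1 * y ^+ 2 + y ^+ 4 != 0 by rewrite gt_eqF.
(* A primitive of the spectral density: the chain rule supplies the factor xi, and eta0 / 2
   compensates the numerator 2 in the derivative of [V1]. *)
pose F := (eta0 / 2) \*: (V1 eta1 \o (fun k => k * xi)).
have dF (k : R) : is_derive k 1 F (spectral_density eta0 eta1 xi k).
  have d1 : is_derive k 1 (fun k : R => k * xi) xi.
    have -> : (fun k : R => k * xi) = xi \*: id.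
      by apply/funext => y /=; rewrite mulrC.
    by apply: is_derive_eq; rewrite /GRing.scale/= mulr1.
  have d2 := is_derive_V1 (k * xi) heta1.
  by apply: is_derive_eq; rewrite /GRing.scale/= /spectral_density; field.
have cF : continuous F.
  by move=> k; apply/differentiable_continuous/derivable1_diffP; exact: ex_derive.
have cf : continuous (spectral_density eta0 eta1 xi).
  move=> k; rewrite /spectral_density.
  apply: cvgM; first exact: cvg_cst.
  apply: cvgV => //.
  have cX n : {for k, continuous (fun k : R => (k * xi) ^+ n)}.
    apply: (@continuous_comp _ _ _ (fun k : R => k * xi) (fun y => y ^+ n)).
      by apply: cvgMl; exact: cvg_id.
    exact: exprn_continuous.
  apply: cvgD; last exact: cX.
  apply: cvgD; first exact: cvg_cst.
  by apply: cvgM; [exact: cvg_cst|exact: cX].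
(* At lag 0 the exponential is 1, so the integrand is real and the imaginary part integrates to
   0. *)
have -> : FGC_SSRF_covariance eta0 eta1 xi kc 0 =
    ((2 * pi)^-1)%:C * (Rintegral lebesgue_measure `[- kc, kc]
       (spectral_density eta0 eta1 xi))%:C.
  rewrite /FGC_SSRF_covariance /Cintegral; congr (_ * (_ +i* _)).
    congr Rintegral; apply/funext => k.
    by rewrite /expi mulr0 cos0 sin0 /= mul1r mul0r subr0.
  under eq_Rintegral do rewrite /expi mulr0 cos0 sin0 /= mulr0 mul0r addr0.
  by rewrite Rintegral_cst//= mul0r.
rewrite -rmorphM/=; congr (_%:C).
rewrite /Rintegral (@continuous_FTC2 _ _ F); first last.
- by move=> k _; rewrite derive1E; apply: derive_val.
- split=> [k _||]; first exact: ex_derive.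
    by apply: cvg_at_right_filter; exact: cF.
  by apply: cvg_at_left_filter; exact: cF.
- exact: continuous_subspaceT.
- lra.
(* By oddness, F(kc) - F(- kc) = eta0 V1(kc xi). *)
rewrite -EFinB/= /F /= /GRing.scale/= mulNr V1N.
have := pi_gt0 R; move: (pi : R) => p p0.
by field; rewrite gt_eqF.
Qed.

Theorem proposition1 (R : realType) (eta0 eta1 xi kc : R)
    (heta0 : 0 < eta0) (hxi : 0 < xi) (hkc : 0 < kc) (heta1 : -2 < eta1) :
  FGC_SSRF_covariance eta0 eta1 xi kc 0
    = (eta0 / (2 * pi) * V1 eta1 (kc * xi))%:C
  /\ forall (d : measure_display) (T : measurableType d) (P : probability T R)
       (X : R -> {RV P >-> R}),
       is_FGC_SSRF eta0 eta1 xi kc X ->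
       forall s : R,
         'V_P[X s]%E = (eta0 / (2 * pi) * V1 eta1 (kc * xi))%:E.
Proof.
have G0 := FGC_SSRF_covariance0 eta0 hxi hkc heta1; split=> // d T P X [_ _ covX] s.
(* The variance is the covariance of [X s] with itself, hence the lag 0 value; injectivity of the
   embedding of the reals identifies [c] with the closed form. *)
have [c covc] := covX s 0.
by rewrite G0 addr0 in covc * => -[->].
Qed.
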